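(* Let $n,k,d\ge1$ and let $S_n$ act on $V_k=(\mathbb R^n)^{\otimes k}$ by permuting each of the $k$ indices simultaneously, and likewise on $W_d=(\mathbb R^n)^{\otimes d}$. For a partition of $n$ encoded by $\mathbf m=(\mathbf m_1,\dots,\mathbf m_n)\in\mathbb N_0^n$ with $\sum_t t\,\mathbf m_t=n$ (here $\mathbf m_t$ is the number of parts of size $t$), and formal variables $s_1,s_2,\dots$, set $$Z(S_n^{(k)})[s]=\sum_{\mathbf m\in P_n}\frac{1}{\prod_{t=1}^n t^{\mathbf m_t}\mathbf m_t!}\prod_{(j_1,\dots,j_k)\in[n]^k} s_{\mathrm{lcm}(j_1,\dots,j_k)}^{\prod_{t=1}^k \mathbf m_{j_t}j_t/\mathrm{lcm}(j_1,\dots,j_k)},$$ and $Z_W(S_n^{(k)}\times S_n^{(d)})[s]$ given by the same expression with each summand additionally multiplied by $\mathbf m_1^{\,d}$. Then, as formal power series in $x$, (i) $\sum_{c\ge0}\dim_{\mathbb R}\big(\mathbb R[V_k]^{S_n}_c\big)\,x^c = Z(S_n^{(k)})[s_i=1+x^i+x^{2i}+\cdots]$, where $\mathbb R[V_k]^{S_n}_c$ is the space of $S_n$-invariant homogeneous polynomials of degree $c$ on $V_k$; and (ii) $\sum_{c\ge0}\dim_{\mathbb R}\big((\mathbb R[V_k]_c\otimes W_d)^{S_n}\big)\,x^c=Z_W(S_n^{(k)}\times S_n^{(d)})[s_i=1+x^i+x^{2i}+\cdots]$, where $(\mathbb R[V_k]_c\otimes W_d)^{S_n}$ is the space of $S_n$-equivariant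 polynomial maps $V_k\to W_d$ whose components are homogeneous of degree $c$.
   Context: $P_n$ denotes the set of integer partitions of $n$, each encoded by its multiplicity vector $\mathbf m$. $\mathrm{lcm}$ is the least common multiple. Exponents $\prod_t \mathbf m_{j_t}j_t/\mathrm{lcm}$ equal to $0$ give factor $1$. A map $P:V_k\to W_d$ is equivariant if $P(g\cdot v)=g\cdot P(v)$ for all $g\in S_n$. *)

(* Defs.v *)
From HB Require Import structures.
From mathcomp Require Import all_boot all_order all_algebra all_fingroup.
From mathcomp Require Import reals.
From mathcomp.multinomials Require Import mpoly.

Set Implicit Arguments.
Unset Strict Implicit.
Unset Printing Implicit Defensive.

Import Order.TTheory GRing.Theory Num.Theory.
Local Open Scope ring_scope.

Definition is_dim (R : fieldType) (V : lmodType R) (P : V -> Prop) (d : nat) :=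
  exists b : 'I_d -> V,
    [/\ forall i, P (b i),
        (forall a : 'I_d -> R, \sum_(i < d) a i *: b i = 0 -> forall i, a i = 0)
      & (forall v, P v -> exists a : 'I_d -> R, v = \sum_(i < d) a i *: b i)].

(* Index set [n]^k of the standard basis e_{i_1} (x) ... (x) e_{i_k}   *)
(* of (R^n)^{(x)k}; index values 0..n-1 stand for 1..n.                *)
Definition tidx (n k : nat) := {ffun 'I_k -> 'I_n}.
Definition tdim (n k : nat) := #|{: tidx n k}|.

Definition tvec (R : Type) (n k : nat) := 'I_(tdim n k) -> R.

(* action of g in S_n: g . e_u = e_{g o u}, so (g.v)_u = v_{g^-1 o u} *)
Definition tact (R : Type) (n k : nat) (g : 'S_n) (v : tvec R n k) : tvec R n k :=
  fun i => v (enum_rank [ffun t => (g^-1)%g (enum_val i t)] : 'I_(tdim n k)).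

Definition polyV (R : nzRingType) (n k : nat) := {mpoly R[tdim n k]}.

Definition inv_hpoly (R : nzRingType) (n k c : nat) (p : polyV R n k) : Prop :=
  p \is c.-homog /\ forall (g : 'S_n) (v : tvec R n k), p.@[tact g v] = p.@[v].

Definition equiv_hmap (R : nzRingType) (n k d c : nat)
    (P : {ffun 'I_(tdim n d) -> polyV R n k}) : Prop :=
  (forall w, P w \is c.-homog) /\
  forall (g : 'S_n) (v : tvec R n k),
    (fun w => (P w).@[tact g v]) = tact g (fun w => (P w).@[v]).

(* Cycle index side.  A partition of n is encoded by its multiplicity *)
(* vector m : 'I_n -> nat, where m t is the number of parts of size   *)
(* t+1 (the ordinal t stands for the part size t+1).                  *)
Definition partn (n : nat) := {ffun 'I_n -> 'I_n.+1}.
Definition is_partn (n : nat) (m : partn n) : bool :=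
  \sum_(t < n) (t.+1 * m t)%N == n.

Definition lcm_tuple (n k : nat) (j : tidx n k) : nat :=
  \big[lcmn/1%N]_(t < k) (j t).+1.

Definition cyc_exp (n k : nat) (m : partn n) (j : tidx n k) : nat :=
  (\prod_(t < k) (m (j t) * (j t).+1)) %/ lcm_tuple j.

Definition mult1 (n : nat) (m : partn n) : nat :=
  \sum_(t < n | val t == 0%N) (m t : nat).

Definition cyc_coef (R : fieldType) (n : nat) (m : partn n) : R :=
  ((\prod_(t < n) ((t.+1) ^ m t * (m t)`!))%N)%:R^-1.

(* Truncation at degree c of the formal power series                  *)
(* 1 + x^i + x^{2i} + ... (exact in all degrees <= c when i >= 1).    *)
Definition geom_trunc (R : nzRingType) (c i : nat) : {poly R} :=
  \sum_(a < c.+1) 'X^(a * i).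

(* coefficient of x^c in Z(S_n^{(k)})[s_i = 1 + x^i + x^{2i} + ...],  *)
(* the extra factor m_1^{dd} gives Z_W (take dd = 0 for Z).           *)
(* Since every substituted series has constant term 1, truncating the *)
(* series at degree c does not change the coefficient of x^c.         *)
Definition Z_coef (R : fieldType) (n k dd c : nat) : R :=
  \sum_(m : partn n | is_partn m)
     cyc_coef R m * (mult1 m ^ dd)%:R *
     (\prod_(j : tidx n k) geom_trunc R c (lcm_tuple j) ^+ cyc_exp m j)`_c.

(* Main.v *)
Require Import Defs.
From HB Require Import structures.
From mathcomp Require Import all_boot all_order all_algebra all_fingroup.
From mathcomp Require Import reals.
From mathcomp.multinomials Require Import mpoly.
From mathcomp Require Import boolp zify ring.

(** Both spaces are spaces of invariants of a permutation representation: the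
    pairs (monomial of degree c on V_k, index in [n]^d) form a basis permuted by
    S_n, and part (i) is the case d = 0. So the dimension is the number of
    orbits, which Burnside's lemma turns into the average number of fixed pairs.

    A monomial is fixed by g when its exponents are constant on the cycles of g
    on [n]^k, so the fixed monomials are counted by the product over these
    cycles C of 1 + x^|C| + x^(2|C|) + ... . The cycle of a tuple has length the
    lcm of the lengths of the cycles of its entries, so this product depends
    only on the cycle type m of g and is the product in Z; the fixed indices in
    [n]^d number m_1^d.

    It remains to see that n! / prod_t t^m_t m_t! permutations have type m. A
    permutation of x |: A is uniquely tperm x y * s with s a permutation of A,
    which inserts x after y in its cycle of s; the resulting recursion on the
    number of permutations of a given type is solved by this formula. *)

Set Implicit Arguments.
Unset Strict Implicit.
Unset Printing Implicit Defensive.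

Import Order.TTheory GRing.Theory Num.Theory.

Local Open Scope nat_scope.

(** * Permutations with a given cycle type *)

Section CycleTypeCount.
Variable T : finType.
Implicit Types (s : {perm T}) (A : {set T}) (x y z : T).

Lemma porbit_sub s x A :
  x \in A -> (forall z, z \in A -> s z \in A) -> porbit s x \subset A.
Proof.
move=> xA sA; apply/subsetP=> _ /porbitP[i ->].
by elim: i => [|i IH]; rewrite ?expg0 ?perm1 // expgSr permM sA.
Qed.

Lemma porbit_step s x : porbit s (s x) = porbit s x.
Proof. by have := porbit_perm s 1 x; rewrite expg1. Qed.

Lemma porbit_closedE s x z : (s z \in porbit s x) = (z \in porbit s x).
Proof. by rewrite -!eq_porbit_mem porbit_step. Qed.

Lemma porbit_const (S : Type) (f : T -> S) s x z :
  (forall y, f (s y) = f y) -> z \in porbit s x -> f z = f x.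
Proof.
move=> fs /porbitP[i ->].
by elim: i => [|i IH]; rewrite ?expg0 ?perm1 // expgSr permM fs.
Qed.

Lemma porbit_fix s x : s x = x -> porbit s x = [set x].
Proof.
move=> sx; apply/eqP; rewrite eqEsubset sub1set porbit_id andbT.
by apply: porbit_sub => [|z]; rewrite !inE // => /eqP ->; rewrite sx.
Qed.

Lemma porbit_perm_on s A x : perm_on A s -> x \in A -> porbit s x \subset A.
Proof. by move=> sA xA; apply: porbit_sub => // z; rewrite perm_closed. Qed.

(** Products apply the left factor first, so the new permutation sends [y] to [x] and [x] to [s y],
    and agrees with [s] elsewhere. Each inclusion holds because one side is closed under the
    permutation that generates the other. *)
Lemma porbit_insert s x y : s x = x -> y != x ->
  porbit (tperm x y * s)%g y = x |: porbit s y.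
Proof.
move=> sx yx; set s' := (tperm x y * s)%g.
have s'x : s' x = s y by rewrite permM tpermL.
have s'y : s' y = x by rewrite permM tpermR.
have s'z z : z != x -> z != y -> s' z = s z.
  by move=> zx zy; rewrite permM tpermD // eq_sym.
apply/eqP; rewrite eqEsubset; apply/andP; split.
  apply: porbit_sub => [|z]; first by rewrite !inE porbit_id orbT.
  have [-> _|zx] := eqVneq z x.
    by rewrite s'x !inE porbit_closedE porbit_id orbT.
  have [-> _|zy] := eqVneq z y; first by rewrite s'y !inE eqxx.
  by rewrite s'z // !inE porbit_closedE (negPf zx) /= => ->; rewrite orbT.
have xC : x \in porbit s' y by rewrite -{1}s'y porbit_closedE porbit_id.
rewrite subUset sub1set xC /=.
apply: porbit_sub => [|z zC]; first exact: porbit_id.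
have [->|zx] := eqVneq z x; first by rewrite sx.
have [->|zy] := eqVneq z y; first by rewrite -s'x porbit_closedE.
by rewrite -s'z // porbit_closedE.
Qed.

(** The [s]-cycle of [z] meets neither [x] nor [y], so all powers of both permutations agree at
    [z]. *)
Lemma porbit_insert_out s x y z : s x = x -> z != x -> z \notin porbit s y ->
  porbit (tperm x y * s)%g z = porbit s z.
Proof.
move=> sx zx zy; set s' := (tperm x y * s)%g.
have E i : (s' ^+ i)%g z = (s ^+ i)%g z.
  elim: i => [|i IH]; first by rewrite !expg0.
  rewrite !expgSr !permM IH; congr (s _); rewrite tpermD //.
    apply: contraNneq zx => xE.
    have: z \in porbit s x by rewrite porbit_sym xE mem_porbit.
    by rewrite porbit_fix // inE.
  by apply: contraNneq zy => ->; rewrite porbit_perm porbit_id.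
by apply/porbit_setP=> w; apply/porbitP/porbitP => -[i ->]; exists i.
Qed.

(** Points are counted instead of cycles, which avoids divisions: [m q] cycles of length [q] contain
    [q * m q] points. *)
Definition ctype A s q := #|[set z in A | #|porbit s z| == q]|.

Lemma ctype0 A s : ctype A s 0 = 0.
Proof.
apply/eqP; rewrite cards_eq0; apply/eqP/setP=> z.
by rewrite !inE (negPf (card_porbit_neq0 _ _)) andbF.
Qed.

(* Length of the cycle into which [x] is inserted, 0 when [x] stays fixed. *)
Definition inslen s x y := if y == x then 0 else #|porbit s y|.

(** A cycle of length l becomes one of length l+1, so l points leave the count at l and l+1 points
    enter the count at l+1. The additive form avoids truncated subtraction. *)
Lemma ctype_insert A s x y q : x \notin A -> perm_on A s -> y \in x |: A ->
  ctype (x |: A) (tperm x y * s)%g q + (q == inslen s x y) * q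
  = ctype A s q + (q == (inslen s x y).+1) * q.
Proof.
move=> xA sA yxA; have sx : s x = x by apply: out_perm xA.
rewrite /inslen; have [yx|yx] := eqVneq y x.
  rewrite yx tperm1 mul1g {yx yxA}.
  have -> : (q == 0) * q = 0 by case: q.
  rewrite addn0 /ctype (cardsD1 x) !inE eqxx porbit_fix // cards1 /= addnC.
  congr (_ + _); last by case: eqP => [<-|/eqP]; rewrite ?mul1n // eq_sym => /negPf ->.
  apply: eq_card => z; rewrite !inE; have [->|] //= := eqVneq z x.
  by rewrite (negPf xA).
have yA : y \in A by move: yxA; rewrite !inE (negPf yx).
have sub := porbit_perm_on sA yA.
have xy : x \notin porbit s y by apply: contra xA => /(subsetP sub).
set s' := (tperm x y * s)%g; have s'y : porbit s' y = _ := porbit_insert sx yx.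
(* The points off the cycle of [y], common to both counts. *)
set D := [set z in A | (z \notin porbit s y) && (#|porbit s z| == q)].
have -> : ctype A s q = (q == #|porbit s y|) * q + #|D|.
  rewrite /ctype -(cardsID (porbit s y)); congr (_ + _).
    rewrite [q == _]eq_sym; case: eqP => [<-|/eqP neq].
      rewrite mul1n; apply: eq_card => z; rewrite !inE andbC.
      case zC: (z \in porbit s y) => //=; rewrite (subsetP sub) //=.
      by move: zC; rewrite -eq_porbit_mem => /eqP ->; rewrite eqxx.
    apply/eqP; rewrite mul0n cards_eq0; apply/eqP/setP=> z; rewrite !inE andbC.
    case zC: (z \in porbit s y) => //=; move: zC; rewrite -eq_porbit_mem => /eqP ->.
    by rewrite (negPf neq) andbF.
  by apply: eq_card => z; rewrite !inE; case: (z \in A); rewrite /= ?andbF.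
have -> : ctype (x |: A) s' q = (q == #|porbit s y|.+1) * q + #|D|.
  rewrite /ctype -(cardsID (porbit s' y)); congr (_ + _).
    have cE : #|porbit s' y| = #|porbit s y|.+1 by rewrite s'y cardsU1 xy.
    rewrite [q == _]eq_sym -cE; case: eqP => [<-|/eqP neq].
      rewrite mul1n; apply: eq_card => z; rewrite !inE andbC.
      case zC: (z \in porbit s' y) => //=.
      have -> : (z == x) || (z \in A).
        move: zC; rewrite s'y !inE; case: eqP => //= _; exact: (subsetP sub).
      by move: zC; rewrite -eq_porbit_mem => /eqP ->; rewrite eqxx.
    apply/eqP; rewrite mul0n cards_eq0; apply/eqP/setP=> z; rewrite !inE andbC.
    case zC: (z \in porbit s' y) => //=; move: zC; rewrite -eq_porbit_mem => /eqP ->.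
    by rewrite (negPf neq) andbF.
  apply: eq_card => z; rewrite !inE s'y !inE negb_or.
  have [->|zx] := eqVneq z x; first by rewrite (negPf xA) /=.
  case zC: (z \in porbit s y) => /=; first by rewrite andbF.
  by rewrite /s' porbit_insert_out // zC.
lia.
Qed.

Lemma inslenE A s x y : x \notin A -> perm_on A s -> y \in x |: A ->
  (inslen s x y).+1 = #|porbit (tperm x y * s)%g x|.
Proof.
move=> xA sA yxA; have sx : s x = x by apply: out_perm xA.
rewrite /inslen; have [->|yx] := eqVneq y x.
  by rewrite tperm1 mul1g porbit_fix // cards1.
have yA : y \in A by move: yxA; rewrite !inE (negPf yx).
have -> : porbit (tperm x y * s)%g x = x |: porbit s y.
  rewrite -porbit_insert //; apply/eqP; rewrite eq_porbit_mem.
  by rewrite porbit_insert // !inE eqxx.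
rewrite cardsU1 (contra _ xA) // => xC.
exact: (subsetP (porbit_perm_on sA yA)).
Qed.

Lemma tperm_on_setU1 A x y : y \in x |: A -> perm_on (x |: A) (tperm x y).
Proof.
move=> yA; apply: subset_trans (tperm_on _ _) _.
by rewrite subUset !sub1set yA !inE eqxx.
Qed.

(** Permutations are sorted by the preimage [y] of [x]; composing with [tperm x y] leaves a
    permutation that fixes [x], hence one of [A]. *)
Lemma sum_perm_on_setU1 (x : T) A (F : {perm T} -> nat) : x \notin A ->
  \sum_(s | perm_on (x |: A) s) F s =
  \sum_(y in x |: A) \sum_(s | perm_on A s) F (tperm x y * s)%g.
Proof.
move=> xA; rewrite (partition_big (fun s : {perm T} => s^-1%g x) (mem (x |: A))) /=;
  last first.
  by move=> s sA; rewrite perm_closed ?perm_onV // !inE eqxx.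
apply: eq_bigr => y yA; rewrite (reindex_inj (mulgI (tperm x y))) /=.
apply: eq_bigl => s; rewrite (can2_eq (permK _) (permKV _)) invgK permM tpermR.
rewrite [x == _]eq_sym; apply/andP/idP => [[sA /eqP sx]|sA].
  have {}sA : perm_on (x |: A) s.
    by rewrite -[s](mulKg (tperm x y)) tpermV perm_onM // tperm_on_setU1.
  apply/subsetP=> z; rewrite inE => szz.
  have: z \in x |: A by apply: (subsetP sA); rewrite inE.
  by rewrite !inE => /orP[/eqP zx|//]; rewrite zx sx eqxx in szz.
split; last by rewrite (out_perm sA xA).
by apply: perm_onM (tperm_on_setU1 yA) (subset_trans sA (subsetUr _ _)).
Qed.

(** * The recursion on cycle types and its solution *)

Variable M : nat.

(** The bound [M] on cycle lengths stays fixed while [A] shrinks in the induction. *)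
Definition has_ctype A s (m : nat -> nat) :=
  [forall q : 'I_M.+1, ctype A s q == q * m q].

(** The order of the centralizer of a permutation of type [m]; the factor at [q = 0] is 1 when
    [m 0 = 0]. *)
Definition zfact (m : nat -> nat) := \prod_(q < M.+1) (q ^ m q * (m q)`!).

(* Multiplicities before [x] is inserted into a cycle of length [l]. *)
Definition mprev (m : nat -> nat) l q :=
  if q == l.+1 then (m q).-1 else if (q == l) && (0 < l) then (m q).+1 else m q.

Lemma mprev_out m l q : q != l.+1 -> q != l -> mprev m l q = m q.
Proof. by rewrite /mprev => /negPf -> /negPf ->. Qed.

(** Only the factors at l and l+1 change. The conditional on the left is the number of places [y] at
    which [x] can be inserted into a cycle of length l. *)
Lemma zfact_mprev m l : l < M -> 0 < m l.+1 ->
  zfact m * (if l == 0 then 1 else l * mprev m l l) =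
  zfact (mprev m l) * (l.+1 * m l.+1).
Proof.
move=> lM ml; rewrite /zfact.
have lM' : l.+1 < M.+1 by [].
have l'M : l < M.+1 by apply: ltnW.
rewrite (bigD1 (Ordinal lM')) //= [in RHS](bigD1 (Ordinal lM')) //=.
have -> : mprev m l l.+1 = (m l.+1).-1 by rewrite /mprev eqxx.
case E: (m l.+1) ml => [//|a] _ /=; rewrite expnS factS.
case: (posnP l) => [l0|l0].
  rewrite (eq_bigr (fun q : 'I_M.+1 => q ^ mprev m l q * (mprev m l q)`!)).
    by ring.
  move=> q ql; rewrite /mprev (_ : (q == l.+1 :> nat) = false); last exact: negPf ql.
  by rewrite l0 andbF.
rewrite [in LHS](bigD1 (Ordinal l'M)) /=; last by rewrite -val_eqE /= neq_ltn ltnSn.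
rewrite [in RHS](bigD1 (Ordinal l'M)) /=; last by rewrite -val_eqE /= neq_ltn ltnSn.
have -> : mprev m l l = (m l).+1 by rewrite /mprev eqxx l0 ltn_eqF.
rewrite [in LHS](eq_bigr (fun q : 'I_M.+1 => q ^ mprev m l q * (mprev m l q)`!)).
  by rewrite expnS factS; ring.
by move=> q /andP[q1 q2]; rewrite mprev_out.
Qed.

Lemma sum_mprev m l : l < M -> 0 < m l.+1 ->
  \sum_(q < M.+1) q * m q = (\sum_(q < M.+1) q * mprev m l q).+1.
Proof.
move=> lM ml.
have lM' : l.+1 < M.+1 by [].
have l'M : l < M.+1 by apply: ltnW.
rewrite (bigD1 (Ordinal lM')) //= [in RHS](bigD1 (Ordinal lM')) //=.
rewrite [in LHS](bigD1 (Ordinal l'M)) /=; last by rewrite -val_eqE /= neq_ltn ltnSn.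
rewrite [in RHS](bigD1 (Ordinal l'M)) /=; last by rewrite -val_eqE /= neq_ltn ltnSn.
have -> : mprev m l l.+1 = (m l.+1).-1 by rewrite /mprev eqxx.
have E : l * mprev m l l = l * m l + l.
  rewrite /mprev ltn_eqF // eqxx; case: (posnP l) => [->//|l0 /=].
  by rewrite mulnS addnC.
rewrite E [in LHS](eq_bigr (fun q : 'I_M.+1 => q * mprev m l q)).
  case: (m l.+1) ml => // a _ /=; lia.
by move=> q /andP[q1 q2]; rewrite mprev_out.
Qed.

(** This is [ctype_insert] read at every length. Positivity comes from [x], which lies on a cycle of
    length l+1 after the insertion; it also makes the predecessor in [mprev] exact. *)
Lemma has_ctype_insert A s x y m : x \notin A -> perm_on A s -> y \in x |: A ->
  inslen s x y < M -> has_ctype (x |: A) (tperm x y * s)%g m =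
  (0 < m (inslen s x y).+1) && has_ctype A s (mprev m (inslen s x y)).
Proof.
move=> xA sA yA lM; set l := inslen s x y in lM *.
have ins q := @ctype_insert A s x y q xA sA yA.
apply/forallP/andP => [H|[ml /forallP H] q].
  have ml : 0 < m l.+1.
    have /eqP := H (Ordinal (lM : l.+1 < M.+1)); move/eqP => /= /eqP.
    case: (m _) => //; rewrite muln0 => /eqP; rewrite cards_eq0 => /eqP/setP/(_ x).
    by rewrite !inE eqxx /= -(inslenE xA sA yA) eqxx.
  split=> //; apply/forallP=> q; have /eqP Hq := H q; move: (ins q).
  rewrite Hq /mprev -/l; case: (posnP l) => [l0|l0]; last first.
    by do 2 case: eqP => ?; case: (m q) ml Hq => [|a]; rewrite ?andbT; lia.
  rewrite l0 andbF; case: eqP => [q0|]; first by rewrite q0 /= !muln0 !mul0n; lia.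
  by case: eqP => [->|]; rewrite ?mul1n ?mul0n ?addn0; case: (m 1) ml; lia.
have /eqP Hq := H q; move: (ins q); rewrite Hq /mprev -/l.
case: (posnP l) => [l0|l0].
  rewrite l0 andbF; case: eqP => [q0|]; first by rewrite q0 /= ctype0.
  rewrite l0 in ml.
  by case: eqP => [->|]; rewrite ?mul1n ?mul0n ?addn0; case: (m 1) ml; lia.
rewrite andbT; case: eqP => [ql|]; case: eqP => [ql'|] /=; try lia.
by rewrite ql'; case: (m l.+1) ml => // a _; lia.
Qed.

Lemma card_inslen A s x l m : x \notin A -> perm_on A s -> l < M ->
  has_ctype A s m ->
  #|[set y in x |: A | inslen s x y == l]| = if l == 0 then 1 else l * m l.
Proof.
move=> xA sA lM /forallP Hm; rewrite /inslen; case: (posnP l) => [->|l0] /=.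
  rewrite -(cards1 x); apply: eq_card => y; rewrite !inE.
  have [->|yx] := eqVneq y x; first by rewrite eqxx.
  by rewrite (negPf (card_porbit_neq0 _ _)) andbF.
have /eqP /= <- := Hm (Ordinal (ltnW lM : l < M.+1)).
apply: eq_card => y; rewrite !inE; have [->|yx] //= := eqVneq y x.
by rewrite (negPf xA) eq_sym (gtn_eqF l0).
Qed.

(** Induction on [#|A|], removing a point [x]. By [zfact_mprev] and the induction hypothesis, the
    permutations with [x] on a cycle of length l+1 contribute a! (l+1) m_(l+1), where a+1 is the
    size of [A]; summing over l gives a! (a+1). *)
Theorem card_perm_ctype A (m : nat -> nat) : #|A| <= M -> m 0 = 0 ->
  \sum_(q < M.+1) q * m q = #|A| ->
  #|[set s | perm_on A s & has_ctype A s m]| * zfact m = #|A|`!.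
Proof.
have [a cA] : exists a, #|A| = a by eexists.
elim: a A m cA => [|a IH] A m cA.
  move=> _ m0; rewrite cA => /eqP; rewrite sum_nat_eq0 => /forallP Hm.
  have mq (q : 'I_M.+1) : m q = 0.
    by have := Hm q; rewrite /= muln_eq0; case/orP=> /eqP // ->.
  have -> : zfact m = 1 by apply: big1 => q _; rewrite mq.
  move/eqP: cA; rewrite cards_eq0 => /eqP ->.
  rewrite muln1 -[_`!]/(1) -(cards1 (1%g : {perm T})); apply: eq_card => s.
  rewrite !inE; apply/andP/eqP => [[/subsetP s0 _]|->].
    by apply/permP=> z; rewrite perm1; apply/eqP/negPn/negP=> /s0; rewrite inE.
  split; first exact: perm_on1.
  apply/forallP=> q; rewrite mq muln0 cards_eq0; apply/eqP/setP=> z.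
  by rewrite !inE.
move=> AM m0 Hm.
have [x xA'] : exists x, x \in A by apply/set0Pn; rewrite -cards_eq0 cA.
have xA : x \notin A :\ x by rewrite !inE eqxx.
have cA' : #|A :\ x| = a by apply/eqP; rewrite -eqSS -cA (cardsD1 x A) xA'.
have EA : A = x |: A :\ x by rewrite setD1K.
rewrite EA in AM Hm *; move: (A :\ x) xA cA' AM Hm => B xB cB AM Hm {EA A cA xA'}.
have cxB : #|x |: B| = a.+1 by rewrite cardsU1 xB cB.
rewrite cxB in AM Hm *.
have lM s y : perm_on B s -> y \in x |: B -> inslen s x y < M.
  move=> sB yB; rewrite (inslenE xB sB yB); apply: leq_trans AM; rewrite -cxB.
  apply: subset_leq_card; apply: porbit_perm_on; last by rewrite !inE eqxx.
  by apply: perm_onM (tperm_on_setU1 yB) (subset_trans sB (subsetUr _ _)).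
(* The permutations are counted as pairs of [s] and [y], with an added sum over l in which only
   [inslen s x y] contributes. *)
have -> : #|[set s | perm_on (x |: B) s & has_ctype (x |: B) s m]| =
    \sum_(l < M) \sum_(s | perm_on B s) \sum_(y in x |: B)
      (inslen s x y == l) * ((0 < m l.+1) && has_ctype B s (mprev m l)).
  rewrite -sum1dep_card big_mkcondr /= sum_perm_on_setU1 // exchange_big /=.
  rewrite [in RHS]exchange_big /=; apply: eq_bigr => s sB.
  rewrite [in RHS]exchange_big /=; apply: eq_bigr => y yB.
  have lt := lM s y sB yB; rewrite (bigD1 (Ordinal lt)) //= eqxx mul1n big1.
    by rewrite addn0 (has_ctype_insert _ xB sB yB lt); case: ifP.
  by move=> l; rewrite -val_eqE /= eq_sym => /negPf ->.
rewrite big_distrl /=.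
rewrite (eq_bigr (fun l : 'I_M => a`! * (l.+1 * m l.+1))).
  by rewrite -big_distrr /= factS -Hm big_ord_recl mul0n add0n mulnC.
move=> [l lt] _ /=; case: (posnP (m l.+1)) => [ml|ml].
  rewrite ml !muln0 big1 // => s _.
  by rewrite big1 // => y _; rewrite muln0.
have cB' : #|B| <= M by rewrite cB ltnW.
have m'0 : mprev m l 0 = 0 by rewrite /mprev /= m0; case: l {lt ml}.
have := IH B (mprev m l) cB cB' m'0; rewrite cB => <-; last first.
  by apply/eqP; rewrite -eqSS -Hm -sum_mprev.
rewrite -mulnA -zfact_mprev // mulnCA mulnC; congr (_ * _).
rewrite -sum1dep_card big_distrl big_mkcondr /=; apply: eq_bigr => s sB.
rewrite -big_distrl /=; case: ifP => [hc|_]; last by rewrite muln0.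
rewrite muln1 mul1n -(card_inslen xB sB lt hc) -sum1dep_card [in RHS]big_mkcondr /=.
by apply: eq_bigr => y _; case: eqP.
Qed.

End CycleTypeCount.

(** * Products over the cycles of a permutation *)

Section PermOrbits.
Variable U : finType.
Implicit Types (s : {perm U}) (A : {set U}).

(** Dividing [i] by the cycle length leaves a remainder below it, and the points of one turn around
    the cycle are distinct. *)
Lemma permX_fixE s x i : ((s ^+ i)%g x == x) = (#|porbit s x| %| i).
Proof.
set L := #|porbit s x|; have L0 : 0 < L by rewrite lt0n card_porbit_neq0.
have sL q : (s ^+ (q * L))%g x = x.
  elim: q => [|q IH]; first by rewrite mul0n expg0 perm1.
  by rewrite mulSn expgD permM [(s ^+ L)%g x]permX iter_porbit.
rewrite {1}(divn_eq i L) expgD permM sL /dvdn permX.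
have rL : i %% L < L by rewrite ltn_mod.
have := uniq_traject_porbit s x; rewrite -/L => /(nth_uniq x).
move=> /(_ (i %% L) 0); rewrite size_traject => /(_ rL L0) <-.
by rewrite !nth_traject.
Qed.

Lemma partition_big_porbits (R : Type) (idx : R) (op : Monoid.com_law idx) s A
    (F : U -> R) : (forall u, (s u \in A) = (u \in A)) ->
  \big[op/idx]_(u in A) F u =
  \big[op/idx]_(C in porbit s @: A) \big[op/idx]_(u in C) F u.
Proof.
move=> sA; rewrite (partition_big_imset (porbit s)) /=.
apply: eq_bigr => _ /imsetP[u uA ->]; apply: eq_bigl => v.
by rewrite eq_porbit_mem andb_idl // => /(@porbit_const _ _ (fun w => w \in A) _ _ _ sA) /= ->.
Qed.

Lemma porbits_imsetT s : porbits s = porbit s @: setT.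
Proof. by apply/setP=> C; apply/imsetP/imsetP => -[u _ ->]; exists u. Qed.

Lemma card_porbits_uniform s A l : (forall u, (s u \in A) = (u \in A)) ->
  {in A, forall u, #|porbit s u| = l} -> #|porbit s @: A| * l = #|A|.
Proof.
move=> sA lA; rewrite -[RHS]sum1_card (partition_big_porbits _ _ sA) -sum_nat_const.
by apply: eq_bigr => _ /imsetP[u uA ->]; rewrite sum1_card lA.
Qed.

(** The points of type [j] form a union of cycles, all of length [len j], which gives the number of
    these cycles by division. *)
Lemma prod_porbits_type (R : comPzRingType) s (J : finType) (ty : U -> J)
    (len : J -> nat) (h : nat -> R) :
  (forall u, ty (s u) = ty u) -> (forall u, #|porbit s u| = len (ty u)) ->
  (\prod_(C in porbits s) h #|C| =
   \prod_j h (len j) ^+ (#|[set u | ty u == j]| %/ len j))%R.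
Proof.
move=> tys lens; pose A j := [set u | ty u == j].
have tyC u v : v \in porbit s u -> ty v = ty u by apply: porbit_const.
have mem_imA u j : (porbit s u \in porbit s @: A j) = (j == ty u).
  apply/imsetP/eqP => [[v]|->]; last by exists u; rewrite ?inE.
  rewrite inE => /eqP <- /eqP; rewrite eq_porbit_mem => /tyC; exact: esym.
(* Each cycle has exactly one type, so a product over types can be inserted and exchanged with the
   product over cycles. *)
rewrite (eq_bigr (fun C => \prod_(j | C \in porbit s @: A j) h #|C|)%R); last first.
  by move=> _ /imsetP[u _ ->]; rewrite (eq_bigl _ _ (mem_imA u)) big_pred1_eq.
rewrite (exchange_big_dep xpredT) //=; apply: eq_bigr => j _.
rewrite (eq_bigr (fun=> h (len j))); last first.
  move=> C /andP[_ /imsetP[u uA CE]]; move: uA; rewrite inE => /eqP <-.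
  by rewrite CE lens.
rewrite (eq_bigl (mem (porbit s @: A j))) /=; last first.
  move=> C /=; rewrite andb_idl // => /imsetP[u _ ->]; exact: imset_f.
rewrite prodr_const; case: (posnP #|A j|) => [A0|/card_gt0P[u]].
  by rewrite A0 div0n (cards0_eq A0) imset0 cards0.
rewrite inE => /eqP <-.
rewrite -(@card_porbits_uniform s (A (ty u)) (len (ty u))) ?mulnK //.
- by rewrite -lens lt0n card_porbit_neq0.
- by move=> v; rewrite !inE tys.
- by move=> v; rewrite inE lens => /eqP ->.
Qed.

(** Expanding the product chooses one exponent per cycle; choosing a on a cycle C adds a |C| to the
    degree. Exponents up to [c] match the truncation. *)
Lemma card_inv_ffun (R : comNzRingType) s c :
  (#|[set f : {ffun U -> 'I_c.+1} |
       (\sum_u (f u : nat))%N == c & [forall u, f (s u) == f u]]|%:R =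
   (\prod_(C in porbits s) geom_trunc R c #|C|)`_c)%R.
Proof.
(* Choices take the default [ord0] on sets that are not cycles, which makes [e] injective on
   them. *)
pose F := pfamily (ord0 : 'I_c.+1) (mem (porbits s)) (fun=> predT).
pose e (phi : {ffun {set U} -> 'I_c.+1}) := [ffun u => phi (porbit s u)].
rewrite /geom_trunc (big_distr_big_dep ord0) /= coef_sum.
rewrite (eq_bigr (fun phi : {ffun {set U} -> 'I_c.+1} =>
    ((\sum_u (e phi u : nat) == c) : nat)%:R)%R); last first.
  move=> phi _; rewrite prodrXr coefXn eq_sym; congr (nat_of_bool (_ == _))%:R%R.
  rewrite (_ : \sum_u (e phi u : nat) = \sum_(u in setT) phi (porbit s u)); last first.
    by apply: eq_big => u; rewrite ?inE // ffunE.
  rewrite (@partition_big_porbits _ _ _ s setT) /=; last by move=> u; rewrite !inE.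
  rewrite porbits_imsetT; apply: eq_bigr => _ /imsetP[u _ ->].
  rewrite mulnC -sum_nat_const; apply: eq_bigr => v.
  by rewrite -eq_porbit_mem => /eqP ->.
pose D := [set phi in F | \sum_u (e phi u : nat) == c].
rewrite -natr_sum; congr (_%:R)%R; transitivity #|D|; last first.
  rewrite -sum1_card big_mkcond [in RHS]big_mkcond /=; apply: eq_bigr => phi _.
  by rewrite in_set; case: (_ == c); rewrite ?andbT ?andbF //; case: ifP.
rewrite -(card_in_imset (f := e) (D := D)); last first.
  move=> p1 p2; rewrite !in_set => /andP[/pfamilyP[/subsetP p1F _] _].
  move=> /andP[/pfamilyP[/subsetP p2F _] _] /ffunP ep; apply/ffunP=> C.
  have [/imsetP[u _ ->]|CF] := boolP (C \in porbits s).
    by have := ep u; rewrite !ffunE.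
  have /eqP -> : p1 C == ord0 by apply: contraR CF => /p1F.
  by apply/esym/eqP; apply: contraR CF => /p2F.
apply: eq_card => f; rewrite inE; apply/andP/imsetP => [[fc /forallP fs]|].
  have fC u v : v \in porbit s u -> f v = f u.
    by apply: porbit_const => w; apply/eqP.
  (* The inverse of [e] reads [f] at any point of the cycle, [f] being constant there. *)
  pose phi := [ffun C => if [pick u | porbit s u == C] is Some u then f u else ord0].
  have fE : f = e phi.
    apply/ffunP=> u; rewrite !ffunE; case: pickP => [v|/(_ u)]; last by rewrite eqxx.
    by rewrite eq_porbit_mem => /fC.
  exists phi; rewrite // in_set -fE fc andbT; apply/pfamilyP; split=> //.
  apply/subsetP=> C; rewrite inE /= ffunE; case: pickP => [v /eqP <- _|]; last by rewrite eqxx.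
  exact: imset_f.
move=> [phi]; rewrite in_set => /andP[_ phic] ->; split=> //.
by apply/forallP=> u; rewrite !ffunE porbit_step.
Qed.

End PermOrbits.

(** * The action on index tuples *)

Lemma card_ffun_forall (I T : finType) (P : I -> pred T) :
  #|[set u : {ffun I -> T} | [forall t, P t (u t)]]| = \prod_t #|P t|.
Proof.
transitivity #|(family P : simpl_pred {ffun I -> T})|.
  by apply: eq_card => u; rewrite inE; apply/forallP/familyP.
by rewrite card_family foldrE big_image.
Qed.

Section TupleAction.
Variable n : nat.
Implicit Types (g : 'S_n) (m : Defs.partn n).

Definition idxact k g (u : tidx n k) : tidx n k := [ffun t => g (u t)].

Lemma idxact_inj k g : injective (@idxact k g).
Proof.
move=> u v /ffunP uv; apply/ffunP=> t.
by have := uv t; rewrite !ffunE => /perm_inj.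
Qed.

Definition idxperm k g : {perm tidx n k} := perm (@idxact_inj k g).

Lemma idxpermE k g u t : @idxperm k g u t = g (u t).
Proof. by rewrite permE ffunE. Qed.

Lemma idxperm1 k (u : tidx n k) : idxperm k 1%g u = u.
Proof. by apply/ffunP=> t; rewrite idxpermE perm1. Qed.

Lemma idxpermM k g h (u : tidx n k) :
  idxperm k (g * h)%g u = idxperm k h (idxperm k g u).
Proof. by apply/ffunP=> t; rewrite !idxpermE permM. Qed.

Lemma idxpermKV k g (u : tidx n k) : idxperm k g (idxperm k g^-1%g u) = u.
Proof. by rewrite -idxpermM mulVg idxperm1. Qed.

Lemma idxpermK k g (u : tidx n k) : idxperm k g^-1%g (idxperm k g u) = u.
Proof. by rewrite -idxpermM mulgV idxperm1. Qed.

Lemma idxpermX k g u i t : (@idxperm k g ^+ i)%g u t = (g ^+ i)%g (u t).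
Proof.
elim: i => [|i IH]; first by rewrite !expg0 !perm1.
by rewrite !expgSr !permM idxpermE IH.
Qed.

(** A power of [g] fixes [u] exactly when it fixes every entry, so both numbers have the same
    multiples. *)
Lemma card_porbit_idxperm k g (u : tidx n k) :
  #|porbit (idxperm k g) u| = \big[lcmn/1]_(t < k) #|porbit g (u t)|.
Proof.
have dvdE i : (#|porbit (idxperm k g) u| %| i) =
              (\big[lcmn/1]_(t < k) #|porbit g (u t)| %| i).
  rewrite -permX_fixE; apply/eqP/dvdn_biglcmP => [/ffunP H t _|H].
    by rewrite -permX_fixE -idxpermX H.
  by apply/ffunP=> t; apply/eqP; rewrite idxpermX permX_fixE H.
by apply/eqP; rewrite eqn_dvd dvdE dvdnn /= -dvdE dvdnn.
Qed.

Lemma card_porbit_pred_lt g i : #|porbit g i|.-1 < n.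
Proof.
rewrite prednK ?lt0n ?card_porbit_neq0 //.
by rewrite -[X in _ <= X]card_ord max_card.
Qed.

Definition clen g i : 'I_n := Ordinal (card_porbit_pred_lt g i).

Lemma clenS g i : (clen g i).+1 = #|porbit g i|.
Proof. by rewrite /= prednK // lt0n card_porbit_neq0. Qed.

(** The cycle type of [g]; [inord] is exact because there are at most [n] cycles of each length. *)
Definition ptype g : Defs.partn n :=
  [ffun t => inord #|porbit g @: [set i | clen g i == t]|].

Lemma ptypeE g (t : 'I_n) : t.+1 * ptype g t = #|[set i | clen g i == t]|.
Proof.
have E : #|porbit g @: [set i | clen g i == t]| * t.+1 = #|[set i | clen g i == t]|.
  apply: card_porbits_uniform => i.
    by rewrite !inE -!val_eqE /= porbit_step.
  by rewrite !inE => /eqP <-; rewrite clenS.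
rewrite ffunE inordK 1?mulnC // ltnS.
have : #|[set i | clen g i == t]| <= n by rewrite -[X in _ <= X]card_ord max_card.
by apply: leq_trans; rewrite -E leq_pmulr.
Qed.

Lemma ctype_clen g (t : 'I_n) : ctype setT g t.+1 = #|[set i | clen g i == t]|.
Proof. by apply: eq_card => i; rewrite !inE -clenS eqSS val_eqE. Qed.

Lemma ptype_is_partn g : is_partn (ptype g).
Proof.
apply/eqP; under eq_bigr do rewrite ptypeE -sum1dep_card.
rewrite -[RHS]card_ord -sum1_card [in RHS](partition_big (clen g) xpredT) //=.
Qed.

Lemma card_ptype m : is_partn m ->
  #|[set g | ptype g == m]| * \prod_(t < n) (t.+1 ^ m t * (m t)`!) = n`!.
Proof.
move=> /eqP Hm.
(* Multiplicities indexed by the length itself, extended by 0 to length 0 and to lengths above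
   [n]. *)
pose mm q := if q is q'.+1 then oapp (fun t : 'I_n => m t : nat) 0 (insub q') else 0.
have mmE (t : 'I_n) : mm t.+1 = m t by rewrite /mm valK.
have cT : #|[set: 'I_n]| = n by rewrite cardsT card_ord.
have := @card_perm_ctype _ n [set: 'I_n] mm; rewrite cT => /(_ (leqnn _) erefl).
rewrite big_ord_recl mul0n add0n => H.
have {H} := H (etrans (eq_bigr _ (fun (t : 'I_n) _ => congr1 (muln t.+1) (mmE t))) Hm).
rewrite /zfact big_ord_recl /= expn0 mul1n mul1n => <-; congr (_ * _); last first.
  by apply: eq_bigr => t _; rewrite -mmE.
apply: eq_card => g; rewrite !inE; apply/eqP/andP => [gm|[_ /forallP H]].
  split; first by apply/subsetP=> i _; rewrite inE.
  apply/forallP=> q.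
  case: (unliftP ord0 q) => [t ->|->]; last by rewrite ctype0.
  by rewrite lift0 mmE -gm ctype_clen -ptypeE.
apply/ffunP=> t; apply/val_inj/eqP; have := H (lift ord0 t).
by rewrite lift0 mmE ctype_clen -ptypeE eqn_mul2l /=.
Qed.

(** The type of a tuple records the cycle lengths of its entries. It is invariant, its lcm is the
    length of the cycle of the tuple, and the tuples of type [j] number the product of the m_(j_t)
    j_t. *)
Lemma prod_porbits_idxperm (R : comPzRingType) k g (h : nat -> R) :
  (\prod_(C in porbits (idxperm k g)) h #|C| =
   \prod_(j : tidx n k) h (lcm_tuple j) ^+ cyc_exp (ptype g) j)%R.
Proof.
pose ty (u : tidx n k) : tidx n k := [ffun t => clen g (u t)].
rewrite (@prod_porbits_type _ _ _ _ ty (@lcm_tuple n k)).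
- apply: eq_bigr => j _; congr (_ ^+ (_ %/ _))%R.
  under eq_bigr do rewrite mulnC ptypeE.
  rewrite (_ : [set u | ty u == j] =
      [set u : tidx n k | [forall t, [pred i | clen g i == j t] (u t)]]).
    by rewrite (card_ffun_forall (fun t => [pred i | clen g i == j t]));
      apply: eq_bigr => t _; rewrite -cardsE.
  apply/setP=> u; rewrite !inE; apply/eqP/forallP => [/ffunP H t|H].
    by rewrite /= -H ffunE.
  by apply/ffunP=> t; rewrite ffunE (eqP (H t)).
- by move=> u; apply/ffunP=> t; rewrite !ffunE; apply/val_inj; rewrite /= idxpermE porbit_step.
- move=> u; rewrite card_porbit_idxperm; apply: eq_bigr => t _.
  by rewrite ffunE clenS.
Qed.

Lemma card_fix_idxperm d g :
  #|[set w : tidx n d | idxperm d g w == w]| = mult1 (ptype g) ^ d.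
Proof.
have fixE : #|[pred i | g i == i]| = mult1 (ptype g).
  have E (t : 'I_n) : val t = 0 -> ptype g t = #|[pred i | g i == i]| :> nat.
    move=> t0; have := ptypeE g t; rewrite t0 mul1n => ->; rewrite -cardsE.
    apply: eq_card => i; rewrite !inE -val_eqE /= t0.
    have := permX_fixE g i 1; rewrite expg1 dvdn1 => ->.
    by have := card_porbit_neq0 g i; case: #|_| => [|[]].
  rewrite /mult1; case: (posnP n) => [n0|n0].
    rewrite big1; last by move=> t _; have := ltn_ord t; rewrite {2}n0.
    by apply/eqP; rewrite -leqn0 -n0 -[X in _ <= X]card_ord max_card.
  by rewrite (big_pred1 (Ordinal n0)) ?E // => t; rewrite -val_eqE.
rewrite -fixE -[X in _ ^ X]card_ord -prod_nat_const.
rewrite -(card_ffun_forall (fun=> [pred i | g i == i])).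
apply: eq_card => w; rewrite !inE; apply/eqP/forallP => [/ffunP H t|H].
  by rewrite /= -idxpermE H.
by apply/ffunP=> t; rewrite idxpermE (eqP (H t)).
Qed.

End TupleAction.

Local Open Scope ring_scope.

(** * Permutation representations *)

(** The sums of [b] over the orbits form a basis, since invariance means that coefficients are
    constant on orbits. *)
Lemma is_dim_orbits (R : fieldType) (V : lmodType R) (aT : finGroupType)
    (T : finType) (to : {action aT &-> T}) (S : {set T}) (b : T -> V)
    (P : V -> Prop) :
  [acts [set: aT], on S | to] ->
  (forall a : T -> R, \sum_(t in S) a t *: b t = 0 -> {in S, forall t, a t = 0}) ->
  (forall v, P v <-> exists2 a : T -> R,
     (forall g, {in S, forall t, a (to t g) = a t}) & v = \sum_(t in S) a t *: b t) ->
  is_dim P #|orbit to [set: aT]%G @: S|.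
Proof.
move=> actS freeb PE; set orb := _ @: S.
have part : partition orb S by apply: orbit_partition.
pose B (i : 'I_#|orb|) := \sum_(t in (enum_val i : {set T})) b t.
have orbM t g : orbit to [set: aT]%G (to t g) = orbit to [set: aT]%G t.
  by rewrite orbit_act ?inE.
have sumB (al : {set T} -> R) : \sum_(i < #|orb|) al (enum_val i) *: B i =
    \sum_(t in S) al (orbit to [set: aT]%G t) *: b t.
  rewrite (set_partition_big _ part) /= [in RHS]big_enum_val /=.
  apply: eq_bigr => i _; rewrite scaler_sumr; apply: eq_bigr => t ti.
  congr (al _ *: _); have /imsetP[u uS E] := enum_valP i.
  by rewrite E in ti *; apply/esym/orbit_eqP.
exists B; split.
- move=> i; apply/PE; exists (fun t => (orbit to [set: aT]%G t == enum_val i)%:R).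
    by move=> g t tS; rewrite orbM.
  rewrite -(sumB (fun O => (O == enum_val i)%:R)) (bigD1 i) //= eqxx scale1r.
  rewrite big1 ?addr0 // => j ji; rewrite (inj_eq enum_val_inj) (negPf ji).
  by rewrite scale0r.
- move=> a a0 i.
  (* The coefficients become a function of the orbit itself; the orbit of index [i] serves as the
     default for [enum_rank_in]. *)
  have rK : a i = a (enum_rank_in (enum_valP i) (enum_val i)) by rewrite enum_valK_in.
  have /imsetP[t tS E] := enum_valP i.
  rewrite rK {2}E.
  apply: (freeb (fun t => a (enum_rank_in (enum_valP i) (orbit to [set: aT]%G t)))) => //.
  rewrite -(sumB (fun O => a (enum_rank_in (enum_valP i) O))) -[RHS]a0.
  by apply: eq_bigr => j _; rewrite enum_valK_in.
move=> v /PE[a ainv ->].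
exists (fun i => if [pick t in (enum_val i : {set T})] is Some t then a t else 0).
rewrite (sumB (fun O : {set T} => if [pick t in O] is Some t then a t else 0)).
apply: eq_bigr => t tS; case: pickP => [u|/(_ t)]; last by rewrite orbit_refl.
by move=> /orbitP[g _ <-]; rewrite ainv.
Qed.

(** * Polynomials and polynomial functions *)

Lemma eq_base_expansion (B n : nat) (a b : 'I_n -> nat) :
  (forall i, a i < B)%N -> (forall i, b i < B)%N ->
  (\sum_(i < n) a i * B ^ i = \sum_(i < n) b i * B ^ i)%N -> a =1 b.
Proof.
elim: n a b => [|n IH] a b aB bB; first by move=> _ [].
rewrite !big_ord_recl /= !expn0 !muln1.
have E (c : 'I_n.+1 -> nat) : (\sum_(i < n) c (lift ord0 i) * B ^ bump 0 i =
    (\sum_(i < n) c (lift ord0 i) * B ^ i) * B)%N.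
  by rewrite big_distrl /=; apply: eq_bigr => i _; rewrite /bump add1n expnSr mulnA.
rewrite !E => H.
have B0 : (0 < B)%N by apply: leq_ltn_trans (aB ord0).
(* The lowest digit is the residue modulo [B]; cancelling it and dividing by [B] leaves the
   remaining digits. *)
have H0 : a ord0 = b ord0.
  by have := congr1 (modn^~ B) H; rewrite /= ![(_ + _ * B)%N]addnC !modnMDl !modn_small.
have H1 : forall i, a (lift ord0 i) = b (lift ord0 i).
  apply: (IH (fun i => a (lift ord0 i)) (fun i => b (lift ord0 i))) => //.
  by apply/eqP; rewrite -(eqn_pmul2r B0); move: H; rewrite H0 => /addnI ->.
by move=> i; case: (unliftP ord0 i) => [j ->|->].
Qed.

(* Kronecker substitution 'X_i := x ^+ (B ^ i) separates the monomials of p. *)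
Lemma meval_eq0 (R : numFieldType) n (p : {mpoly R[n]}) :
  (forall v, p.@[v] = 0) -> p = 0.
Proof.
move=> p0; pose B := msize p.
pose e (m : 'X_{1..n}) := (\sum_(i < n) m i * B ^ i)%N.
pose q := \sum_(m <- msupp p) p@_m *: 'X^(e m) : {poly R}.
have qx x : q.[x] = 0.
  rewrite /q horner_sum -[RHS](p0 (fun i => x ^+ (B ^ i))) mevalE.
  apply: eq_bigr => m _; rewrite hornerZ hornerXn; congr (_ * _).
  rewrite /e -prodrXr; apply: eq_bigr => i _; by rewrite -exprM mulnC.
have q0 : q = 0.
  apply/eqP/negPn/negP => qn0.
  (* The natural numbers below [size q] are distinct in characteristic 0 and would be too many
     roots. *)
  have := max_poly_roots qn0 (rs := [seq i%:R | i <- iota 0 (size q)]).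
  rewrite size_map size_iota ltnn => H; apply/negP: isT; rewrite -{1}H //.
    by apply/allP=> x _; rewrite rootE qx.
  by rewrite map_inj_uniq ?iota_uniq // => i j /eqP; rewrite eqr_nat => /eqP.
have mB m : m \in msupp p -> forall i, (m i < B)%N.
  move=> mp i; apply: leq_ltn_trans (msize_mdeg_lt mp).
  by rewrite mdegE (bigD1 i) //= leq_addr.
apply/mpolyP=> m; rewrite mcoeff0.
have [mp|] := boolP (m \in msupp p); last exact: memN_msupp_eq0.
have := congr1 (fun r : {poly R} => r`_(e m)) q0; rewrite coef0 => <-.
rewrite /q coef_sum (bigD1_seq m) //= ?msupp_uniq // coefZ coefXn eqxx mulr1.
rewrite big_seq_cond big1 ?addr0 // => m' /andP[m'p mm'].
rewrite coefZ coefXn; case: eqP => [E|]; last by rewrite mulr0.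
case/eqP: mm'; apply/mnmP; exact: eq_base_expansion (mB _ m'p) (mB _ mp) (esym E).
Qed.

Lemma meval_inj (R : numFieldType) n (p q : {mpoly R[n]}) :
  (forall v, p.@[v] = q.@[v]) -> p = q.
Proof.
by move=> pq; apply/eqP; rewrite -subr_eq0; apply/eqP/meval_eq0 => v;
  rewrite mevalB pq subrr.
Qed.

Lemma meval_msym (R : comNzRingType) n (s : 'S_n) (p : {mpoly R[n]}) (v : 'I_n -> R) :
  (msym s p).@[v] = p.@[fun i => v (s i)].
Proof.
rewrite {1}[p]mpolyE (raddf_sum (msym s)) (raddf_sum (meval v)) [in RHS]mevalE /=.
apply: eq_bigr => m _; rewrite msymZ mevalZ msymX mevalX; congr (_ * _).
rewrite (reindex_inj (@perm_inj _ s)) /=; apply: eq_bigr => i _.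
by rewrite mnmE permK.
Qed.

(** * The monomial basis *)

Section PermutationBasis.
Variables (R : numFieldType) (n k d c : nat).

Let U := tidx n k.
Let W := tidx n d.
(** Exponents of a monomial of degree [c] are at most [c], so bounding them keeps the type finite
    without loss. *)
Let X := ({ffun U -> 'I_c.+1} * W)%type.

Definition monact (x : X) (g : 'S_n) : X :=
  ([ffun u => x.1 (idxperm k g^-1%g u)], idxperm d g x.2).

Lemma monact1 : monact^~ 1%g =1 id.
Proof.
move=> [f w]; congr (_, _); rewrite ?idxperm1 //.
by apply/ffunP=> u; rewrite ffunE invg1 idxperm1.
Qed.

Lemma monactM x : act_morph monact x.
Proof.
move=> g h; congr (_, _); rewrite ?idxpermM //.
by apply/ffunP=> u; rewrite !ffunE invMg idxpermM.
Qed.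

Definition monaction : {action 'S_n &-> X} := TotalAction monact1 monactM.

Definition monset : {set X} := [set x : X | (\sum_u (x.1 u : nat))%N == c].

Lemma monset_act g x : (monact x g \in monset) = (x \in monset).
Proof.
rewrite !inE /= [in RHS](reindex_inj (@perm_inj _ (idxperm k g^-1%g))) /=.
by congr (_ == _); apply: eq_bigr => u _; rewrite ffunE.
Qed.

Lemma monset_acts : [acts [set: 'S_n], on monset | monaction].
Proof.
by apply/subsetP=> g _; rewrite !inE; apply/subsetP=> x xS; rewrite inE monset_act.
Qed.

(** A pair is fixed when its exponents are constant on the cycles of [g] and its index is fixed: two
    independent conditions whose counts multiply. *)
Lemma card_fix_monaction g :
  #|'Fix_(monset | monaction)[g]%g|%:R =
  (mult1 (ptype g) ^ d)%:R *
  (\prod_(j : tidx n k) geom_trunc R c (lcm_tuple j) ^+ cyc_exp (ptype g) j)`_c.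
Proof.
rewrite -prod_porbits_idxperm -card_inv_ffun -card_fix_idxperm -natrM mulnC -cardsX.
congr (_%:R); apply: eq_card => -[f w]; rewrite !inE /=.
rewrite -andbA; congr (_ && _).
rewrite sub1set inE; apply/eqP/andP => [[fE wE]|[/forallP fE /eqP wE]].
  split; last by rewrite wE.
  by apply/forallP=> u; rewrite -{1}fE ffunE idxpermK.
congr (_, _) => //; apply/ffunP=> u; rewrite ffunE.
by rewrite -(eqP (fE _)) idxpermKV.
Qed.

Definition mon_of (f : {ffun U -> 'I_c.+1}) : 'X_{1..tdim n k} :=
  [multinom (f (enum_val i) : nat) | i < tdim n k].

Definition exp_of (m : 'X_{1..tdim n k}) : {ffun U -> 'I_c.+1} :=
  [ffun u => inord (m (enum_rank u))].

Lemma mon_ofK : cancel mon_of exp_of.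
Proof. by move=> f; apply/ffunP=> u; rewrite ffunE mnmE enum_rankK inord_val. Qed.

Lemma exp_ofK m : mdeg m = c -> mon_of (exp_of m) = m.
Proof.
move=> mc; apply/mnmP=> i; rewrite mnmE ffunE enum_valK inordK // ltnS -mc.
by rewrite mdegE (bigD1 i) //= leq_addr.
Qed.

Lemma mdeg_mon_of f : mdeg (mon_of f) = (\sum_u (f u : nat))%N.
Proof.
rewrite mdegE [in RHS](reindex_onto enum_val enum_rank) /=.
  by apply: eq_big => i; rewrite ?enum_valK ?eqxx // mnmE.
by move=> u _; rewrite enum_rankK.
Qed.

(** The tensor of a monomial with a standard basis vector of W_d, written in components. *)
Definition mon_basis (x : X) : {ffun 'I_(tdim n d) -> polyV R n k} :=
  [ffun w => if enum_val w == x.2 then 'X_[mon_of x.1] else 0].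

(** Only the pair made of the exponents of [m] and the index of [w] contributes. Both independence
    and spanning follow from this formula. *)
Lemma mcoeff_mon_basis (a : X -> R) w m :
  ((\sum_(x in monset) a x *: mon_basis x) w)@_m =
  if mdeg m == c then a (exp_of m, enum_val w) else 0.
Proof.
have E x : (a x *: mon_basis x) w = if enum_val w == x.2 then a x *: 'X_[mon_of x.1] else 0.
  by rewrite !ffunE; case: eqP; rewrite ?scaler0.
rewrite sum_ffunE raddf_sum /=; case: eqP => mc.
  rewrite (bigD1 (exp_of m, enum_val w)) /=; last by rewrite inE -mdeg_mon_of exp_ofK /= ?mc.
  rewrite E eqxx /= exp_ofK // mcoeffZ mcoeffX eqxx mulr1.
  rewrite big1 ?addr0 // => -[f w'] /andP[_ ne].
  rewrite E /=; case: eqP => [we|_]; last by rewrite mcoeff0.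
  rewrite mcoeffZ mcoeffX; case: eqP => [fm|]; last by rewrite mulr0.
  by case/eqP: ne; rewrite -fm mon_ofK we.
rewrite big1 // => -[f w']; rewrite inE /= -mdeg_mon_of => /eqP fc.
rewrite E /=; case: eqP => [we|_]; last by rewrite mcoeff0.
by rewrite mcoeffZ mcoeffX; case: eqP => [fm|]; rewrite ?mulr0 //; case: mc; rewrite -fm.
Qed.

Lemma mon_basis_free (a : X -> R) :
  \sum_(x in monset) a x *: mon_basis x = 0 -> {in monset, forall x, a x = 0}.
Proof.
move=> a0 [f w]; rewrite inE /= -mdeg_mon_of => fc.
have := mcoeff_mon_basis a (enum_rank w) (mon_of f).
by rewrite a0 fc mon_ofK enum_rankK ffunE mcoeff0.
Qed.

Definition varact (g : 'S_n) (i : 'I_(tdim n k)) : 'I_(tdim n k) :=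
  enum_rank (idxperm k g^-1%g (enum_val i)).

Lemma varact_inj g : injective (varact g).
Proof. by move=> i j /enum_rank_inj/perm_inj/enum_val_inj. Qed.

Definition varperm g := perm (@varact_inj g).

Lemma varpermE g i : varperm g i = enum_rank (idxperm k g^-1%g (enum_val i)).
Proof. exact: permE. Qed.

Lemma meval_tact g (p : polyV R n k) (v : tvec R n k) :
  p.@[tact g v] = (msym (varperm g) p).@[v].
Proof.
rewrite meval_msym; apply: meval_eq => i; rewrite varpermE /tact.
by congr (v (enum_rank _)); apply/ffunP=> t; rewrite ffunE idxpermE.
Qed.

Lemma exp_of_varact g (m : 'X_{1..tdim n k}) u :
  exp_of [multinom m (varperm g i) | i < tdim n k] u =
  exp_of m (idxperm k g^-1%g u).
Proof. by rewrite !ffunE mnmE varpermE enum_rankK. Qed.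

Lemma tactE g T (v : tvec T n d) w :
  tact g v w = v (enum_rank (idxperm d g^-1%g (enum_val w))).
Proof.
by rewrite /tact; congr (v (enum_rank _)); apply/ffunP=> t; rewrite ffunE idxpermE.
Qed.

(** Since polynomials are determined by their values, equivariance at all points becomes an identity
    of polynomials; compared coefficientwise, it says that [a] is constant on orbits. *)
Lemma equiv_hmapE (P : {ffun 'I_(tdim n d) -> polyV R n k}) :
  equiv_hmap c P <-> exists2 a : X -> R,
    (forall g, {in monset, forall x, a (monaction x g) = a x}) &
    P = \sum_(x in monset) a x *: mon_basis x.
Proof.
split=> [[homP eqP_]|[a ainv ->]].
  exists (fun x => (P (enum_rank x.2))@_(mon_of x.1)); last first.
    apply/ffunP=> w; apply/mpolyP=> m; rewrite mcoeff_mon_basis /= enum_valK.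
    case: eqP => [mc|/eqP mc]; first by rewrite exp_ofK.
    exact: dhomog_nemf_coeff (homP w) mc.
  move=> g [f w] _ /=.
  (* Equivariance read at the component g w, where (g P(v))_(g w) = P(v)_w. *)
  have : msym (varperm g) (P (enum_rank (idxperm d g w))) = P (enum_rank w).
    apply: meval_inj => v; rewrite -meval_tact.
    by rewrite (congr1 (@^~ _) (eqP_ g v)) tactE enum_rankK idxpermK.
  move=> /(congr1 (mcoeff (mon_of f))); rewrite mcoeff_sym => <-.
  congr (_ @_ _); apply/mnmP=> i; rewrite !mnmE ffunE varpermE.
  by rewrite enum_rankK.
split=> [w|g v].
  apply/dhomogP=> m; rewrite mcoeff_msupp mcoeff_mon_basis.
  by case: (mdeg m =P c) => //; rewrite eqxx.
apply/funext=> w; rewrite tactE meval_tact; congr meval; apply/mpolyP=> m.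
rewrite mcoeff_sym !mcoeff_mon_basis mdeg_mperm; case: eqP => // mc.
(* Invariance is applied to the pair of [m] and g^-1 w, which [g] carries to the pair on the
   left. *)
rewrite enum_rankK -[RHS](ainv g); last by rewrite inE -mdeg_mon_of exp_ofK /= ?mc.
congr a; congr (_, _); last by rewrite idxpermKV.
by apply/ffunP=> u; rewrite exp_of_varact [RHS]ffunE.
Qed.

Lemma is_dim_equiv_hmap : is_dim (@equiv_hmap R n k d c)
  #|orbit monaction [set: 'S_n]%G @: monset|.
Proof. exact: is_dim_orbits monset_acts mon_basis_free equiv_hmapE. Qed.

(** Burnside's lemma, with the sum over the group collected by cycle type; [card_ptype] turns class
    sizes divided by n! into the coefficients of Z. *)
Lemma card_orbits_monset :
  #|orbit monaction [set: 'S_n]%G @: monset|%:R = Z_coef R n k d c.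
Proof.
have n0 : (n`!)%:R != 0 :> R by rewrite pnatr_eq0 -lt0n fact_gt0.
apply: (mulIf n0); rewrite -natrM.
have := Frobenius_Cauchy monset_acts; rewrite cardsT card_Sn => <-.
rewrite natr_sum /Z_coef mulr_suml.
rewrite (partition_big (@ptype n) (@is_partn n)) /=; last by move=> g _; apply: ptype_is_partn.
apply: eq_bigr => m Hm.
rewrite (eq_bigr (fun=> (mult1 m ^ d)%:R *
    (\prod_(j : tidx n k) geom_trunc R c (lcm_tuple j) ^+ cyc_exp m j)`_c)); last first.
  by move=> g /andP[_ /eqP <-]; rewrite card_fix_monaction.
rewrite (eq_bigl (mem [set g | ptype g == m])); last by move=> g; rewrite !inE.
rewrite sumr_const -[LHS]mulr_natr /cyc_coef; move: n0; rewrite -(card_ptype Hm) natrM.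
rewrite mulf_eq0 negb_or => /andP[_].
(* Here n! is the class size [N] times [z], so [z] is nonzero and cancels against [cyc_coef]. *)
by move: (\prod_(t < n) _)%N%:R (#|_|%:R) (_ ^ d)%N%:R => z N a z0; field.
Qed.

End PermutationBasis.

(** * Invariant polynomials as equivariant maps to W_0 *)

Lemma tidx0_eq n (w w' : 'I_(tdim n 0)) : w = w'.
Proof. by apply: enum_val_inj; apply/ffunP=> -[]. Qed.

(** The only index of W_0 is the empty tuple, so S_n acts trivially on W_0 and an equivariant map
    amounts to its single invariant component. *)
Lemma is_dim_inv_hpoly (R : fieldType) (n k c D : nat) :
  is_dim (@equiv_hmap R n k 0 c) D -> is_dim (@inv_hpoly R n k c) D.
Proof.
have w0 : 'I_(tdim n 0) by apply: enum_rank; apply: [ffun t => _] => -[].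
move=> [b [bP bfree bspan]]; exists (fun i => b i w0); split.
- move=> i; have [bh be] := bP i; split=> // g v.
  by rewrite (congr1 (@^~ w0) (be g v)) /tact; congr (b i _).@[v]; apply: tidx0_eq.
- move=> a a0; apply: bfree; apply/ffunP=> w.
  rewrite sum_ffunE [RHS]ffunE -[RHS]a0; apply: eq_bigr => i _.
  by rewrite ffunE (tidx0_eq w w0).
move=> p [ph pinv].
have /bspan[a E] : @equiv_hmap R n k 0 c [ffun=> p].
  split=> [w|g v]; first by rewrite ffunE.
  by apply/funext=> w; rewrite [RHS]/tact !ffunE.
exists a; have := congr1 (fun f : {ffun _ -> _} => f w0) E.
rewrite ffunE => ->; rewrite sum_ffunE; apply: eq_bigr => i _.
by rewrite ffunE.
Qed.

Theorem mainTheorem9 (R : realType) (n k d : nat) :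
  (1 <= n)%N -> (1 <= k)%N -> (1 <= d)%N ->
  (forall c : nat,
     exists dimc : nat,
       is_dim (fun p : polyV R n k => @inv_hpoly R n k c p) dimc /\
       dimc%:R = Z_coef R n k 0 c) /\
  (forall c : nat,
     exists dimc : nat,
       is_dim (fun P : {ffun 'I_(tdim n d) -> polyV R n k} => @equiv_hmap R n k d c P) dimc /\
       dimc%:R = Z_coef R n k d c).
Proof.
move=> _ _ _; split=> c.
  exists #|orbit (monaction n k 0 c) [set: 'S_n]%G @: monset n k 0 c|; split.
    by apply: is_dim_inv_hpoly; apply: is_dim_equiv_hmap.
  exact: card_orbits_monset.
exists #|orbit (monaction n k d c) [set: 'S_n]%G @: monset n k d c|; split.
  exact: is_dim_equiv_hmap.
exact: card_orbits_monset.
Qed.
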